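(* Let $A\in\mathbb{C}^{n\times n}$ have index $k$ and let $m$ be a positive integer. Then the following assertions hold: (a) $A^{\mathrm{w}_m,\dagger}=\lim_{\lambda\to0}A^k\big(\lambda I_n+(A^k)^*A^{k+m+1}\big)^{-1}(A^k)^*A^{m+1}(\lambda I_n+A^*A)^{-1}A^*$; (b) $A^{\mathrm{w}_m,\dagger}=\lim_{\lambda\to0}A^k(A^k)^*\big(\lambda I_n+A^{k+m+1}(A^k)^*\big)^{-1}A^{m+1}(\lambda I_n+A^*A)^{-1}A^*$; (c) $A^{\mathrm{w}_m,\dagger}=\lim_{\lambda\to0}\big(\lambda I_n+A^k(A^k)^*A^{m+1}\big)^{-1}A^k(A^k)^*A^{m+1}(\lambda I_n+A^*A)^{-1}A^*$.
   Context: $r(\cdot)$ and $(\cdot)^*$ denote rank and conjugate transpose; $A^\dagger$ is the Moore-Penrose inverse and $A^D$ the Drazin inverse. The index of $A\in\mathbb{C}^{n\times n}$ is the smallest nonnegative integer $k$ with $r(A^{k+1})=r(A^k)$ (with $A^0=I_n$). Limits are taken over nonzero $\lambda\to 0$ (the inverses exist for all sufficiently small $\lambda\neq0$). For $A$ of index $k$, the core-EP inverse is $A^{\mathrm{cEP}}=A^DA^k(A^k)^\dagger$ and the $m$-weak group inverse is $A^{\mathrm{w}_m}=(A^{\mathrm{cEP}})^{m+1}A^m$. The $m$-weak group MP inverse $A^{\mathrm{w}_m,\dagger}$ is the unique $X\in\mathbb{C}^{n\times n}$ satisfying $XAX=X$, $AX=A_1A^\dagger$ and $XA=A^DA_1$,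 where $A_1=AA^{\mathrm{w}_m}A$. *)

(* Defs.v *)
From HB Require Import structures.
From mathcomp Require Import all_boot all_order all_algebra.
From mathcomp Require Import complex.
From mathcomp Require Import boolp classical_sets reals topology normedtype.

Set Implicit Arguments.
Unset Strict Implicit.
Unset Printing Implicit Defensive.

Import Order.TTheory GRing.Theory Num.Theory.
Import numFieldNormedType.Exports.

Local Open Scope classical_set_scope.
Local Open Scope ring_scope.
Local Open Scope sesquilinear_scope.

(* The library puts a topology on any abstract numFieldType, but not on the
   concrete type R[i]; this transfers it.  Matrices then carry the entrywise
   (product) topology. *)
HB.instance Definition _ (R : realType) := NormedModule.copy R[i] R[i]^o.

Lemma mxindex_exists (F : fieldType) (n : nat) (A : 'M[F]_n) :
  exists k, \rank (A ^+ k.+1) == \rank (A ^+ k).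
Proof.
apply: contrapT => nex.
suff H k : (\rank (A ^+ k) + k <= n)%N by have := leq_trans (leq_addl _ _) (H n.+1); rewrite ltnn.
elim: k => [|k IH]; first by rewrite addn0 rank_leq_row.
rewrite addnS -addSn (leq_trans _ IH) // leq_add2r ltn_neqAle.
by rewrite exprS mxrankM_maxr andbT; apply/negP => h; apply: nex; exists k; rewrite exprS.
Qed.

Definition mxindex (F : fieldType) (n : nat) (A : 'M[F]_n) : nat :=
  ex_minn (mxindex_exists A).

Definition is_mpinv (C : numClosedFieldType) (m n : nat)
    (A : 'M[C]_(m, n)) (X : 'M[C]_(n, m)) : Prop :=
  [/\ A *m X *m A = A, X *m A *m X = X,
      (A *m X) ^t* = A *m X & (X *m A) ^t* = X *m A].

(* Here and below, [xget 0] is a definite description: existence and uniqueness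
   are proved in [mpinvP], [drazinP] and [wgmpP], so the default value 0 is
   never used. *)
Definition mpinv (C : numClosedFieldType) (m n : nat) (A : 'M[C]_(m, n)) :
    'M[C]_(n, m) :=
  xget 0 [set X | is_mpinv A X].

Definition is_drazin (F : fieldType) (n : nat) (A X : 'M[F]_n) : Prop :=
  [/\ X *m A *m X = X, A *m X = X *m A &
      X *m A ^+ (mxindex A).+1 = A ^+ mxindex A].

Definition drazin (F : fieldType) (n : nat) (A : 'M[F]_n) : 'M[F]_n :=
  xget 0 [set X | is_drazin A X].

Definition core_ep (C : numClosedFieldType) (n : nat) (A : 'M[C]_n) : 'M[C]_n :=
  let k := mxindex A in drazin A *m A ^+ k *m mpinv (A ^+ k).

(* The m-weak group inverse. *)
Definition weak_group (C : numClosedFieldType) (n m : nat) (A : 'M[C]_n) :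
    'M[C]_n :=
  core_ep A ^+ m.+1 *m A ^+ m.

(* The defining equations of the m-weak group Moore-Penrose inverse; for all m,
   including m = 0, they have exactly one solution. *)
Definition is_wgmp (C : numClosedFieldType) (n m : nat) (A X : 'M[C]_n) : Prop :=
  let A1 := A *m weak_group m A *m A in
  [/\ X *m A *m X = X, A *m X = A1 *m mpinv A & X *m A = drazin A *m A1].

Definition wgmp (C : numClosedFieldType) (n m : nat) (A : 'M[C]_n) : 'M[C]_n :=
  xget 0 [set X | is_wgmp m A X].

Lemma xget_unique (T : choiceType) (x0 : T) (P : T -> Prop) (y : T) :
  P y -> (forall a b, P a -> P b -> a = b) ->
  forall X, P X <-> X = xget x0 [set x | P x].
Proof.
move=> Py Pu X; have Pg : P (xget x0 [set x | P x]) by apply: (xgetPex _ (ex_intro _ y Py)).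
by split=> [PX|->//]; apply: Pu.
Qed.

Lemma mulmx_trCl_eq0 (C : numClosedFieldType) (m n : nat) (E : 'M[C]_(m, n)) :
  E *m E ^t* = 0 -> E = 0.
Proof.
move=> h; apply/matrixP => i j; rewrite mxE.
have /matrixP /(_ i i) := h; rewrite !mxE => s0.
have s1 : \sum_k `|E i k| ^+ 2 = 0.
  by apply: etrans s0; apply: eq_bigr => k _; rewrite !mxE normCK.
move/psumr_eq0P : s1 => /(_ (fun k _ => exprn_ge0 _ (normr_ge0 _))) /(_ j isT)/eqP.
by rewrite sqrf_eq0 normr_eq0 => /eqP.
Qed.

Lemma trC_mul (C : numClosedFieldType) (m n p : nat)
  (A : 'M[C]_(m, n)) (B : 'M[C]_(n, p)) : (A *m B) ^t* = B ^t* *m A ^t*.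
Proof. by rewrite trmx_mul map_mxM. Qed.

Lemma mulmx_trC_cancel (C : numClosedFieldType) (m n p : nat)
  (F : 'M[C]_(p, m)) (A : 'M[C]_(m, n)) : F *m A *m A ^t* = 0 -> F *m A = 0.
Proof. by move=> h; apply: mulmx_trCl_eq0; rewrite trC_mul mulmxA h mul0mx. Qed.

Lemma trC_mulmx_cancel (C : numClosedFieldType) (m n p : nat)
  (A : 'M[C]_(m, n)) (Y : 'M[C]_(n, p)) : A ^t* *m (A *m Y) = 0 -> A *m Y = 0.
Proof.
move=> h; rewrite -[A *m Y]trmxCK [X in X ^t*](_ : _ = 0) ?trmx0 ?map_mx0 //.
by apply: mulmx_trCl_eq0; rewrite trmxCK trC_mul -mulmxA h mulmx0.
Qed.

Lemma mulmx_trC_herm (C : numClosedFieldType) (n : nat) (P : 'M[C]_n) :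
  P *m P ^t* = P ^t* -> P ^t* = P.
Proof.
move=> h; rewrite -[RHS]trmxCK; move: (P ^t*) (trmxCK P) h => Q <- h.
by rewrite -[in RHS]h trC_mul trmxCK.
Qed.

Lemma mpinv_exists (C : numClosedFieldType) (m n : nat) (A : 'M[C]_(m, n)) :
  exists X, is_mpinv A X.
Proof.
pose S := A ^t* *m A *m A ^t*; pose Z := pinvmx S.
have SZS : S *m Z *m S = S by apply: mulmxKpV.
pose X := A ^t* *m Z *m A ^t*.
have e1 : A *m X *m A = A.
  apply/eqP; rewrite -subr_eq0; apply/eqP.
  rewrite -{3}(mul1mx A) -mulmxBl; apply: mulmx_trC_cancel.
  suff : (A *m (X *m A *m A^t* - A^t*)) = 0.
    by rewrite mulmxBr mulmxBl mul1mx mulmxBl !mulmxA.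
  apply: trC_mulmx_cancel; rewrite mulmxBr mulmxBr.
  by move: SZS; rewrite /S /X !mulmxA => ->; rewrite subrr.
have e3 : (A *m X) ^t* = A *m X.
  have h : A *m X *m (A *m X) ^t* = (A *m X) ^t*.
    have -> : (A *m X) ^t* = A *m (Z ^t* *m A *m A ^t*).
      by rewrite /X !trC_mul trmxCK !mulmxA.
    by rewrite mulmxA e1.
  exact: mulmx_trC_herm.
have e4 : (X *m A) ^t* = X *m A.
  have h : (X *m A) ^t* *m (X *m A) = X *m A.
    have {2 3}-> : X *m A = A ^t* *m (Z *m A ^t* *m A) by rewrite /X !mulmxA.
    by rewrite mulmxA -trC_mul mulmxA e1.
  by move: (X *m A) h => P h; rewrite -[RHS]h -{1}h trC_mul trmxCK.
exists X; split=> //.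
rewrite (_ : X *m A *m X = (X *m A) ^t* *m A ^t* *m Z *m A ^t*).
  by rewrite -trC_mul mulmxA e1.
by rewrite e4 {2}/X !mulmxA.
Qed.

Lemma mpinv_uniq (C : numClosedFieldType) (m n : nat) (A : 'M[C]_(m, n)) X Y :
  is_mpinv A X -> is_mpinv A Y -> X = Y.
Proof.
move=> [x1 x2 x3 x4] [y1 y2 y3 y4].
have l : A *m X = A *m Y.
  have : (A *m Y *m (A *m X)) ^t* = A *m Y by rewrite trC_mul x3 y3 mulmxA x1.
  by rewrite mulmxA y1 x3.
have r : X *m A = Y *m A.
  have : (X *m A *m (Y *m A)) ^t* = Y *m A.
    by rewrite trC_mul x4 y4 -mulmxA (mulmxA A) x1.
  by rewrite -mulmxA (mulmxA A) y1 x4.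
by rewrite -x2 -mulmxA l mulmxA r y2.
Qed.

Lemma mpinvP (C : numClosedFieldType) (m n : nat) (A : 'M[C]_(m, n)) X :
  is_mpinv A X <-> X = mpinv A.
Proof.
have [Y AY] := mpinv_exists A.
exact: (xget_unique _ AY (@mpinv_uniq C m n A)).
Qed.

Lemma mxindex_rank (F : fieldType) (n : nat) (A : 'M[F]_n) :
  \rank (A ^+ (mxindex A).+1) = \rank (A ^+ mxindex A).
Proof. by rewrite /mxindex; case: ex_minnP => k /eqP. Qed.

Lemma mxindex_factorl (F : fieldType) (n k : nat) (A : 'M[F]_n) :
  \rank (A ^+ k.+1) = \rank (A ^+ k) ->
  forall j, exists Y, A ^+ k = Y * A ^+ (j + k).
Proof.
move=> h.
have /mxrank_leqif_sup/geq_leqif : (A *m A ^+ k <= A ^+ k)%MS by apply: submxMl.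
rewrite mulmxE -exprS h leqnn => /esym/submxP[Y hY].
elim=> [|j [Z hZ]]; first by exists 1; rewrite mul1r.
exists (Y * Z); rewrite {1}hY mulmxE [in LHS]exprSr {1}hZ.
by rewrite addSn exprSr !mulrA.
Qed.

Lemma trmx_exp (F : fieldType) (n k : nat) (A : 'M[F]_n) :
  (A ^+ k)^T = A^T ^+ k.
Proof.
elim: k => [|k IH]; first by rewrite !expr0 trmx1.
by rewrite exprS -mulmxE trmx_mul IH mulmxE -exprSr.
Qed.

Lemma mxindex_factorr (F : fieldType) (n k : nat) (A : 'M[F]_n) :
  \rank (A ^+ k.+1) = \rank (A ^+ k) ->
  forall j, exists Y, A ^+ k = A ^+ (j + k) * Y.
Proof.
move=> h j; have [|Y hY] := @mxindex_factorl F n k A^T _ j.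
  by rewrite -!trmx_exp !mxrank_tr.
exists Y^T; apply: trmx_inj.
by rewrite -mulmxE trmx_mul !trmxK !trmx_exp.
Qed.

Lemma drazin_exists (F : fieldType) (n : nat) (A : 'M[F]_n) :
  exists X, is_drazin A X.
Proof.
have h := mxindex_rank A; set k := mxindex A in h.
have [Y hY] := mxindex_factorl h k.+1.
have [Z hZ] := mxindex_factorr h k.+1.
have e : Y * A ^+ k = A ^+ k * Z by rewrite [in LHS]hZ [in RHS]hY mulrA.
exists (Y * A ^+ k); rewrite /is_drazin !mulmxE -/k; split.
- by rewrite {2}e -!mulrA [A * _]mulrA -exprS [A ^+ k * _]mulrA -exprD addnC -hZ.
- have c : A ^+ k * A = A * A ^+ k by rewrite -exprSr -exprS.
  rewrite [in LHS]e mulrA -c {1}hY -!mulrA [A ^+ _ * (A * Z)]mulrA.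
  by rewrite -exprSr exprS -mulrA -hZ -c.
- by rewrite -mulrA -exprD addnC -hY.
Qed.

Lemma drazin_uniq (F : fieldType) (n : nat) (A : 'M[F]_n) X Y :
  is_drazin A X -> is_drazin A Y -> X = Y.
Proof.
rewrite /is_drazin !mulmxE; move: (mxindex A) => k [x1 x2 x3] [y1 y2 y3].
have pw B : B * A * B = B -> A * B = B * A ->
    (A * B = A ^+ k.+1 * B ^+ k.+1) /\ (B = A ^+ k * B ^+ k.+1) .
  move=> b1 b2.
  have P j : B = A ^+ j * B ^+ j.+1.
    elim: j => [|j IH]; first by rewrite mul1r.
    by rewrite exprSr [B ^+ _]exprS [B ^+ _]exprS !mulrA -(mulrA _ A) -(mulrA _ (A * B)) b2 b1
       -mulrA -exprS.
  by split; rewrite // exprS -mulrA -P.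
have [ax xx] := pw X x1 x2; have [ay yy] := pw Y y1 y2.
have yy' : Y = Y ^+ k.+1 * A ^+ k.
  by rewrite {1}yy; apply: commrX; apply/commr_sym/commrX; rewrite /GRing.comm.
have ay' : Y * A = Y ^+ k.+1 * A ^+ k.+1.
  by rewrite [A ^+ _]exprSr mulrA -yy'.
have xe : X = Y * A * X.
  by rewrite {1}xx -{1}y3 -!mulrA -ax.
have ck : A ^+ k.+1 * X = A ^+ k.
  rewrite -x3; apply/commr_sym/commrX; exact: esym.
by rewrite xe ay' -mulrA ck -yy'.
Qed.

Lemma drazinP (F : fieldType) (n : nat) (A : 'M[F]_n) X :
  is_drazin A X <-> X = drazin A.
Proof.
have [Y AY] := drazin_exists A.
exact: (xget_unique _ AY (@drazin_uniq F n A)).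
Qed.

Lemma wgmp_exists (C : numClosedFieldType) (n m : nat) (A : 'M[C]_n) :
  exists X, is_wgmp m A X.
Proof.
have /drazinP[d1 d2 d3] := erefl (drazin A).
have /mpinvP[p1 p2 _ _] := erefl (mpinv (A ^+ mxindex A)).
have /mpinvP[q1 q2 _ _] := erefl (mpinv A).
rewrite /is_wgmp /weak_group; set W := core_ep A.
have : W = core_ep A by []; rewrite /core_ep.
move: d1 d2 d3 p1 p2 q1 q2; rewrite !mulmxE.
move: (mxindex A) (drazin A) (mpinv A) W => k D Am W.
move: (mpinv (A ^+ k)) => Z d1 d2 d3 p1 p2 q1 q2 hW.
have cAD : GRing.comm A D by [].
have cDk : GRing.comm (A ^+ k) D by apply/commr_sym/commrX/commr_sym.
set P := A ^+ k * Z.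
have PP : P * P = P by rewrite /P mulrA p1.
have WE : W = D * P by rewrite hW mulrA.
have DAk : A * D * A ^+ k = A ^+ k by rewrite d2 -mulrA -exprS.
have AW : A * W = P by rewrite WE mulrA /P mulrA DAk.
have PW : P * W = W.
  have -> : W = A ^+ k * (D * Z) by rewrite WE /P !mulrA cDk.
  by rewrite /P mulrA p1.
have WP : W * P = W by rewrite WE -mulrA PP.
have DAW : D * A * W = W by rewrite WE mulrA d1.
have AWj j : A ^+ j.+1 * W ^+ j.+1 = P.
  elim: j => [|j IH]; first by [].
  rewrite [A ^+ _]exprSr [W ^+ _]exprS -mulrA [A * _]mulrA AW.
  by rewrite [W ^+ _]exprS [P * _]mulrA PW -exprS.
pose V := W ^+ m.+1 * A ^+ m.
have VAV : V * A * V = V.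
  rewrite /V -[_ * A ^+ m * A]mulrA -exprSr -!mulrA [A ^+ _ * (_ * _)]mulrA AWj.
  by rewrite mulrA exprSr -[W ^+ m * W * P]mulrA WP.
have DAV : D * A * V = V by rewrite /V exprS !mulrA DAW.
have VAA : V * A * Am * A = V * A by rewrite -!mulrA (mulrA A Am) q1.
exists (V * A * Am); rewrite -/V; clearbody V; split.
- by rewrite VAA !mulrA VAV.
- by rewrite !mulrA.
- by rewrite VAA !mulrA DAV.
Qed.

Lemma wgmp_uniq (C : numClosedFieldType) (n m : nat) (A : 'M[C]_n) X Y :
  is_wgmp m A X -> is_wgmp m A Y -> X = Y.
Proof.
move=> [x1 x2 x3] [y1 y2 y3].
by rewrite -x1 -mulmxA x2 -y2 mulmxA x3 -y3 y1.
Qed.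

Lemma wgmpP (C : numClosedFieldType) (n m : nat) (A : 'M[C]_n) X :
  is_wgmp m A X <-> X = wgmp m A.
Proof.
have [Y AY] := wgmp_exists m A.
exact: (xget_unique _ AY (@wgmp_uniq C n m A)).
Qed.

(* [invmx M] is M itself when M is singular; this never matters in a limit
   over nonzero l -> 0, since l%:M + M is eventually invertible. *)
Lemma near_unitmx (R : realType) (n : nat) (M : 'M[R[i]]_n) :
  \forall l \near (0 : R[i])^', l%:M + M \in unitmx.
Proof.
have [r hr] := closed_field_poly_normal (char_poly (- M)).
have near_notin s : \forall l \near (0 : R[i])^', l \notin [seq x <- s | x != 0].
  elim: s => [|a s IH]; first by apply: nearW.
  rewrite /=; case: eqVneq => //= a0.
  near=> l; rewrite inE negb_or; apply/andP; split; near: l => //.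
  apply: nbhs_dnbhs; apply/nbhs_ballP; exists `|a|; rewrite /= ?normr_gt0 //.
  move=> y; rewrite -ball_normE /= sub0r normrN => ya.
  by apply: contraTneq ya => ->; rewrite ltxx.
near=> l.
have l0 : l != 0 by near: l; exact: nbhs_dnbhs_neq.
have ln : l \notin [seq x <- r | x != 0] by near: l.
rewrite unitmxE unitfE.
have -> : \det (l%:M + M) = (char_poly (- M)).[l].
  rewrite /char_poly -horner_evalE -det_map_mx; congr (\det _).
  apply/matrixP => i j; rewrite !mxE /= horner_evalE !hornerE.
  by rewrite opprK hornerMn hornerX.
apply/negP => /eqP/rootP; rewrite hr rootZ ?(monicP (char_poly_monic _)) ?oner_eq0 //.
rewrite root_prod_XsubC => lr; move/negP: ln; apply.
by rewrite mem_filter l0.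
Unshelve. all: by end_near. Qed.

(* Main.v *)
Require Import Defs.
From mathcomp Require Import all_boot all_order all_algebra.
From mathcomp Require Import complex.
From mathcomp Require Import boolp classical_sets reals topology normedtype.

Set Implicit Arguments.
Unset Strict Implicit.
Unset Printing Implicit Defensive.

Import Order.TTheory GRing.Theory Num.Theory.
Import numFieldNormedType.Exports.

Local Open Scope classical_set_scope.
Local Open Scope ring_scope.
Local Open Scope sesquilinear_scope.

(** All three formulas split as a factor not involving the last resolvent times
    (l + A^t* A)^-1 A^t*.  The two factors converge separately, to
    W ^ (m+1) A ^ (m+1), where W is the core-EP inverse, and to the
    Moore-Penrose inverse of A; the product of the limits is the m-weak group
    MP inverse ([wgmp_core_ep]).

    Both limits are instances of [cvg_regularized_inverse]: if S M X = S and
    X = S U, then (l + S M) X = l S U + S = S (1 + l U), so that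
    (l + S M)^-1 S = X (1 + l U)^-1 for small l <> 0.  The singular limit on the
    left thus becomes the continuity of matrix inversion at the identity, and no
    bound on the resolvent (l + S M)^-1 is needed.  The last factor is the case
    S = A^t*, M = A, X = mpinv A.  The first is the case S = B B^t*,
    M = A ^ (m+1), X = W ^ (m+1) with B = A ^ k: there M X = B (mpinv B) is the
    orthogonal projector onto the range of B ([core_ep_expK]), which gives both
    hypotheses.

    The first factors of (a), (b) and (c) are one and the same matrix
    (l + S M)^-1 S M, by the push-through identity P (l + Q P)^-1 =
    (l + P Q)^-1 P ([invmx_push_through]). *)

(** * Continuity of matrix operations *)

Lemma cvg_mx (T : topologicalType) (I : Type) (F : set_system I) {FF : Filter F}
    (p q : nat) (f : I -> 'M[T]_(p, q)) (M : 'M[T]_(p, q)) :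
  (forall i j, f x i j @[x --> F] --> M i j) -> f x @[x --> F] --> M.
Proof.
move=> fM P [Q QM QP]; rewrite nbhs_simpl.
have : \forall x \near F, forall i j, Q i j (f x i j).
  by apply: filter_forall => i; apply: filter_forall => j; exact: fM _ _ _ (QM i j).
by apply: filterS => x Qx; exact: QP.
Qed.

Lemma cvg_mx_entry (K : numFieldType) (I : Type) (F : set_system I)
    {FF : Filter F} (p q : nat) (f : I -> 'M[K]_(p, q)) (M : 'M[K]_(p, q)) i j :
  f x @[x --> F] --> M -> f x i j @[x --> F] --> M i j.
Proof. by move=> fM; exact: cvg_comp _ _ fM (@coord_continuous K p q i j M). Qed.

Lemma cvg_sum (K : numFieldType) (I J : Type) (F : set_system I) {FF : Filter F}
    (r : seq J) (P : pred J) (f : J -> I -> K) (a : J -> K) :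
  (forall j, f j x @[x --> F] --> a j) ->
  \sum_(j <- r | P j) f j x @[x --> F] --> \sum_(j <- r | P j) a j.
Proof. by move=> fa; apply: cvg_big => //; exact: add_continuous. Qed.

Lemma cvg_prodr (K : numFieldType) (I J : Type) (F : set_system I)
    {FF : Filter F} (r : seq J) (P : pred J) (f : J -> I -> K) (a : J -> K) :
  (forall j, f j x @[x --> F] --> a j) ->
  \prod_(j <- r | P j) f j x @[x --> F] --> \prod_(j <- r | P j) a j.
Proof. by move=> fa; apply: cvg_big => //; exact: mul_continuous. Qed.

Lemma cvg_mulmx (K : numFieldType) (I : Type) (F : set_system I)
    {FF : Filter F} (p q r : nat) (f : I -> 'M[K]_(p, q)) (g : I -> 'M[K]_(q, r))
    (M : 'M[K]_(p, q)) (N : 'M[K]_(q, r)) :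
  f x @[x --> F] --> M -> g x @[x --> F] --> N ->
  f x *m g x @[x --> F] --> M *m N.
Proof.
move=> fM gN; apply: cvg_mx => i j; rewrite mxE.
under eq_fun do rewrite mxE.
by apply: cvg_sum => k; apply: cvgM; exact: cvg_mx_entry.
Qed.

Lemma cvg_det (K : numFieldType) (I : Type) (F : set_system I)
    {FF : Filter F} (p : nat) (f : I -> 'M[K]_p) (M : 'M[K]_p) :
  f x @[x --> F] --> M -> \det (f x) @[x --> F] --> \det M.
Proof.
move=> fM; apply: cvg_sum => s; apply: cvgM; first exact: cvg_cst.
by apply: cvg_prodr => i; exact: cvg_mx_entry.
Qed.

Lemma cvg_near_unitmx (K : numFieldType) (I : Type) (F : set_system I)
    {FF : Filter F} (p : nat) (f : I -> 'M[K]_p) (M : 'M[K]_p) :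
  M \in unitmx -> f x @[x --> F] --> M -> \forall x \near F, f x \in unitmx.
Proof.
rewrite unitmxE unitfE => dM fM.
under eq_near do rewrite unitmxE unitfE.
exact: cvgr_neq0 _ (cvg_det fM) dM.
Qed.

Lemma cvg_invmx (K : numFieldType) (I : Type) (F : set_system I)
    {FF : Filter F} (p : nat) (f : I -> 'M[K]_p) (M : 'M[K]_p) :
  M \in unitmx -> f x @[x --> F] --> M ->
  invmx (f x) @[x --> F] --> invmx M.
Proof.
move=> uM fM; have dM : \det M != 0 by rewrite -unitfE -unitmxE.
apply: (@cvg_trans _ ((\det (f x))^-1 *: \adj (f x) @[x --> F])).
  apply: near_eq_cvg; apply: filterS (cvg_near_unitmx uM fM) => x ux.
  by rewrite /invmx ux.
rewrite /invmx uM; apply: cvg_mx => i j; rewrite !mxE.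
under eq_fun do rewrite !mxE.
apply: cvgM; first by apply: cvgV dM _; exact: cvg_det.
apply: cvgM; first exact: cvg_cst.
apply: cvg_det; apply: cvg_mx => i' j'; rewrite !mxE.
by under eq_fun do rewrite !mxE; exact: cvg_mx_entry.
Qed.

(** * Regularized inverses *)

Lemma invmx_push_through (F : fieldType) (p q : nat) (l : F)
    (P : 'M[F]_(p, q)) (Q : 'M[F]_(q, p)) :
  l%:M + P *m Q \in unitmx -> l%:M + Q *m P \in unitmx ->
  P *m invmx (l%:M + Q *m P) = invmx (l%:M + P *m Q) *m P.
Proof.
move=> uPQ uQP; apply: (canRL (mulKmx uPQ)).
rewrite mulmxA mulmxDl mul_scalar_mx -mulmxA -mul_mx_scalar -mulmxDr.
by rewrite mulmxK.
Qed.

(** The two hypotheses make X the outer inverse of M with the range and the null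
    space of S.  They are used in this form because they turn the equation for
    the regularized inverse into (l + S M) X = S (1 + l U), whose right-hand
    factor is invertible near l = 0. *)
Lemma cvg_regularized_inverse (R : realType) (p q : nat) (S : 'M[R[i]]_(p, q))
    (M : 'M[R[i]]_(q, p)) (X : 'M[R[i]]_(p, q)) (U : 'M[R[i]]_q) :
  S *m M *m X = S -> X = S *m U ->
  invmx (l%:M + S *m M) *m S @[l --> (0 : R[i])^'] --> X.
Proof.
move=> SMX XSU.
have cU : 1%:M + l *: U @[l --> (0 : R[i])^'] --> (1%:M : 'M[R[i]]_q).
  apply: cvg_mx => i j.
  have : (1%:M : 'M[R[i]]_q) i j + l * U i j @[l --> (0 : R[i])^']
      --> (1%:M : 'M[R[i]]_q) i j + 0 * U i j.
    apply: cvgD; first exact: cvg_cst.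
    by apply: cvgM (cvg_cst _); exact: nbhs_dnbhs.
  rewrite mul0r addr0.
  by under [in X in _ -> X]eq_fun do rewrite mxE [X in _ + X]mxE.
have u1 : (1%:M : 'M[R[i]]_q) \in unitmx by exact: unitmx1.
have cX : X *m invmx (1%:M + l *: U) @[l --> (0 : R[i])^'] --> X.
  suff : X *m invmx (1%:M + l *: U) @[l --> (0 : R[i])^'] --> X *m invmx 1%:M.
    by rewrite invmx1 mulmx1.
  by apply: cvg_mulmx; [exact: cvg_cst | exact: cvg_invmx].
apply: cvg_trans cX; apply: near_eq_cvg; near=> l.
have ul : l%:M + S *m M \in unitmx by near: l; exact: near_unitmx.
have uU : 1%:M + l *: U \in unitmx by near: l; exact: cvg_near_unitmx u1 cU.
apply: (canRL (mulKmx ul)); rewrite mulmxA; apply: (canLR (mulmxK uU)).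
by rewrite mulmxDl SMX mul_scalar_mx XSU mulmxDr mulmx1 -scalemxAr addrC.
Unshelve. all: by end_near. Qed.

(** * The Moore-Penrose and core-EP inverses as regularized inverses *)

Lemma mpinv_trC_factor (C : numClosedFieldType) (p q : nat) (A : 'M[C]_(p, q)) :
  mpinv A = A ^t* *m ((mpinv A) ^t* *m mpinv A).
Proof.
have /mpinvP[_ a2 _ a4] := erefl (mpinv A).
by rewrite mulmxA -trC_mul a4 a2.
Qed.

Lemma trC_mulmx_mpinv (C : numClosedFieldType) (p q : nat) (A : 'M[C]_(p, q)) :
  A ^t* *m A *m mpinv A = A ^t*.
Proof.
have /mpinvP[a1 _ a3 _] := erefl (mpinv A).
by rewrite -mulmxA -a3 -trC_mul a1.
Qed.

Lemma cvg_mpinv (R : realType) (p q : nat) (A : 'M[R[i]]_(p, q)) :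
  invmx (l%:M + A ^t* *m A) *m A ^t* @[l --> (0 : R[i])^'] --> mpinv A.
Proof.
exact: cvg_regularized_inverse (trC_mulmx_mpinv A) (mpinv_trC_factor A).
Qed.

Section CoreEP.
Variables (C : numClosedFieldType) (n : nat) (A : 'M[C]_n).
Let B := A ^+ mxindex A.
Let P := B *m mpinv B.

Let mulPB : P *m B = B.
Proof. by have /mpinvP[] := erefl (mpinv B). Qed.

Lemma drazin_mul_pow : drazin A *m A *m B = B.
Proof.
have /drazinP[_ _ d3] := erefl (drazin A).
by rewrite -mulmxA mulmxE -exprS.
Qed.

Lemma mulmx_core_ep : A *m core_ep A = P.
Proof.
have /drazinP[_ d2 _] := erefl (drazin A).
by rewrite /core_ep !mulmxA d2 drazin_mul_pow.
Qed.

Lemma drazin_mul_core_ep : drazin A *m A *m core_ep A = core_ep A.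
Proof.
have /drazinP[d1 _ _] := erefl (drazin A).
by rewrite /core_ep !mulmxA d1.
Qed.

(** The Drazin inverse commutes with B, so the range of the core-EP inverse
    lies in that of B, on which P acts as the identity. *)
Lemma proj_core_ep : P *m core_ep A = core_ep A.
Proof.
have /drazinP[_ d2 _] := erefl (drazin A).
have cBD : drazin A *m B = B *m drazin A.
  by rewrite /B mulmxE; apply: commrX; apply: esym.
by rewrite /core_ep -/B cBD !mulmxA mulPB.
Qed.

Lemma core_ep_expK j : A ^+ j.+1 *m core_ep A ^+ j.+1 = P.
Proof.
elim: j => [|j IH]; first exact: mulmx_core_ep.
rewrite [A ^+ _]exprSr [core_ep A ^+ _]exprS -!mulmxE.
rewrite -mulmxA [A *m (_ *m _)]mulmxA mulmx_core_ep.
by rewrite [core_ep A ^+ _]exprS -mulmxE [P *m _]mulmxA proj_core_ep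
  mulmxE -exprS.
Qed.

Lemma proj_core_ep_exp j : P *m core_ep A ^+ j.+1 = core_ep A ^+ j.+1.
Proof. by rewrite exprS -mulmxE mulmxA proj_core_ep. Qed.

Lemma core_ep_exp_proj j : core_ep A ^+ j.+1 *m P = core_ep A ^+ j.+1.
Proof.
have PP : P *m P = P by rewrite {2}/P mulmxA mulPB.
by rewrite exprSr -mulmxE -mulmxA /core_ep -/B -!mulmxA [B *m _ in LHS]mulmxA PP.
Qed.

(** Since V = W ^ (m+1) A ^ m satisfies V A V = V and D A V = V, the matrix
    V A (mpinv A) solves the three defining equations. *)
Lemma wgmp_core_ep m :
  wgmp m A = core_ep A ^+ m.+1 *m A ^+ m.+1 *m mpinv A.
Proof.
apply/esym/wgmpP.
have /mpinvP[a1 _ _ _] := erefl (mpinv A).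
pose V := weak_group m A.
have VA : core_ep A ^+ m.+1 *m A ^+ m.+1 = V *m A.
  by rewrite /V /weak_group -mulmxA mulmxE -exprSr.
have VAV : V *m A *m V = V.
  by rewrite -VA /V /weak_group -mulmxA [A ^+ _ *m _]mulmxA core_ep_expK
    mulmxA core_ep_exp_proj.
have DAV : drazin A *m A *m V = V.
  by rewrite /V /weak_group exprS -!mulmxE mulmxA [_ *m A *m (_ *m _)]mulmxA
    drazin_mul_core_ep.
have VAAA : V *m A *m mpinv A *m A = V *m A.
  by rewrite -!mulmxA [A *m (_ *m _)]mulmxA a1.
rewrite VA /is_wgmp -/V; clearbody V; split.
- by rewrite VAAA !mulmxA VAV.
- by rewrite !mulmxA.
- by rewrite VAAA !mulmxA DAV.
Qed.

Lemma core_ep_exp_regular j :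
  B *m B ^t* *m A ^+ j.+1 *m core_ep A ^+ j.+1 = B *m B ^t*.
Proof.
by rewrite -!mulmxA core_ep_expK /P [B ^t* *m _]mulmxA trC_mulmx_mpinv.
Qed.

Lemma core_ep_exp_factor j :
  core_ep A ^+ j.+1 =
  B *m B ^t* *m ((mpinv B) ^t* *m mpinv B *m core_ep A ^+ j.+1).
Proof.
by rewrite -{1}proj_core_ep_exp /P {1}mpinv_trC_factor !mulmxA.
Qed.

End CoreEP.

Unset Implicit Arguments.
Set Strict Implicit.

Theorem theorem5p3 (R : realType) (n k m : nat) (A : 'M[R[i]]_n)
    (hk : mxindex A = k) (hm : (0 < m)%N) :
  [/\ (A ^+ k *m invmx (l%:M + (A ^+ k) ^t* *m A ^+ (k + m + 1))
        *m (A ^+ k) ^t* *m A ^+ (m + 1) *m invmx (l%:M + A ^t* *m A) *m A ^t*)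
        @[l --> (0 : R[i])^'] --> wgmp m A,
      (A ^+ k *m (A ^+ k) ^t* *m invmx (l%:M + A ^+ (k + m + 1) *m (A ^+ k) ^t*)
        *m A ^+ (m + 1) *m invmx (l%:M + A ^t* *m A) *m A ^t*)
        @[l --> (0 : R[i])^'] --> wgmp m A
    & (invmx (l%:M + A ^+ k *m (A ^+ k) ^t* *m A ^+ (m + 1))
        *m A ^+ k *m (A ^+ k) ^t* *m A ^+ (m + 1)
        *m invmx (l%:M + A ^t* *m A) *m A ^t*)
        @[l --> (0 : R[i])^'] --> wgmp m A].
Proof.
rewrite -hk wgmp_core_ep !addn1 -addnS {hk hm k}.
set B := A ^+ mxindex A; set M := A ^+ m.+1.
have -> : A ^+ (mxindex A + m.+1) = M *m B by rewrite addnC exprD mulmxE.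
have cvg_c : invmx (l%:M + B *m B ^t* *m M) *m (B *m B ^t*) *m M
    *m (invmx (l%:M + A ^t* *m A) *m A ^t*)
    @[l --> (0 : R[i])^'] --> core_ep A ^+ m.+1 *m M *m mpinv A.
  apply: cvg_mulmx; last exact: cvg_mpinv.
  apply: cvg_mulmx; last exact: cvg_cst.
  exact: cvg_regularized_inverse (core_ep_exp_regular A m)
    (core_ep_exp_factor A m).
split; apply: cvg_trans cvg_c; apply: near_eq_cvg; near=> l.
- have ul : l%:M + B *m (B ^t* *m M) \in unitmx by near: l; exact: near_unitmx.
  have ur : l%:M + B ^t* *m M *m B \in unitmx by near: l; exact: near_unitmx.
  rewrite [B ^t* *m (M *m B)]mulmxA (invmx_push_through ul ur).
  by rewrite !mulmxA.
- have ul : l%:M + B *m B ^t* *m M \in unitmx by near: l; exact: near_unitmx.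
  have ur : l%:M + M *m (B *m B ^t*) \in unitmx by near: l; exact: near_unitmx.
  rewrite -[M *m B *m B ^t*]mulmxA (invmx_push_through ul ur).
  by rewrite !mulmxA.
- by rewrite !mulmxA.
Unshelve. all: by end_near. Qed.
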